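(* Let $0<\ell\in\mathbb R$ and let $x,\hat x>0$. On the equivariant exact Courant algebroid $E_\ell$ over $K=\mathrm{SU}(2)\times\mathrm U(1)$, consider the left-invariant triples $(V_+^x,\operatorname{div}_+^x,\eta_x)$ and $(V_+^{\hat x},\operatorname{div}_+^{\hat x},\eta_{\hat x})$ described in the context. These are exchanged under T-duality, provided that $$\hat x=\frac1{\ell x}.$$
   Context: $K=\mathrm{SU}(2)\times\mathrm U(1)$ has left-invariant vector fields $v_1,\dots,v_4$ with $[v_2,v_3]=-v_1$, $[v_3,v_1]=-v_2$, $[v_1,v_2]=-v_3$, $[v_4,\cdot]=0$, and dual frame $v^1,\dots,v^4$. $E_\ell=TK\oplus T^*K$ with $\langle X+\xi,X+\xi\rangle=\xi(X)$ and Dorfman bracket $[X+\xi,Y+\eta]=[X,Y]+L_X\eta-i_Yd\xi+i_Yi_XH_\ell$, $H_\ell=\ell v^1\wedge v^2\wedge v^3$. The triples: $g_x=\ell(v^1\otimes v^1+v^2\otimes v^2+v^3\otimes v^3+x^2v^4\otimes v^4)$; $V_\pm^x=\{v\pm g_x(v)\}\subset E_\ell$; $\varepsilon^x=-xv^4$; $\operatorname{div}_+^x$ is the restriction to $V_+^x$ of $\operatorname{div}_0-\langle\varepsilon^x,\cdot\rangle$, where $\operatorname{div}_0(X+\xi)=L_X\mu_{g_x}/\mu_{g_x}$; equivalently it is determined by $\varepsilon_+^x=-\frac12(\frac1{\ell x}v_4+xv^4)$, the orthogonal projection of $\varepsilon^x$ to $V_+^x$. $I_x$ is the almost complex structure $I_xv_4=xv_1$,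 $I_xv_2=v_3$, transported to $V_+^x$ by $I_x(v+g_x(v))=I_xv+g_x(I_xv)$, and $\eta_x$ is a non-vanishing left-invariant pure spinor (for the Clifford algebra of $V_+^x$) in the line annihilated by the $+i$-eigenspace $(V_+^x)^{1,0}$ of $I_x$; spinor lines are identified with the complex structures $I_x$. T-duality: $T^1=\mathrm U(1)\subset K$ acts by right multiplication with quotient $\mathrm{SU}(2)$. Let $\hat K$ be a second copy of $K$ (frames $\hat v_j,\hat v^j$), $\overline K=K\times_{\mathrm{SU}(2)}\hat K$ with projections $q,\hat q$, and $\overline B=-v^4\wedge\hat v^4$, so that $q^*H_\ell-\hat q^*\hat H_\ell=0=d\overline B$. The T-duality isomorphism of simple reductions $\psi\colon E_\ell/T^1\to E_\ell/\hat T^1$ (Courant algebroids over $\mathrm{SU}(2)$ whose sections are the $T^1$-invariant sections) is $\psi(X+\xi)=\hat q_*(\overline X+q^*\xi-\overline B(\overline X,\cdot))$, where $\overline X$ is the unique invariant lift of $X$ to $\overline K$ with $q^*\xi(Y)-\overline B(\overline X,Y)=0$ for all $Y$ tangent to the $T^1$-orbits, i.e. generated by $v_4$. The two triples are exchanged under T-duality if $\psi(V_+^x)=V_+^{\hat x}$, $\psi$ carries $\operatorname{div}_+^x$ to $\operatorname{div}_+^{\hat x}$ (equivalently $\psi(\varepsilon_+^x)=\varepsilon_+^{\hat x}$), and $\psi I_x\psi^{-1}=I_{\hat x}$ on $V_+^{\hat x}$ (equivalently the spinor lines correspond). *)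

(* Defs.v *)
From HB Require Import structures.
From mathcomp Require Import all_boot all_order all_algebra.
From mathcomp Require Import complex spectral.
From mathcomp Require Import all_classical all_reals all_analysis.
From mathcomp Require Import ring lra.

Set Implicit Arguments.
Unset Strict Implicit.
Unset Printing Implicit Defensive.

Import Order.TTheory GRing.Theory Num.Theory numFieldNormedType.Exports.
Local Open Scope classical_set_scope.
Local Open Scope ring_scope.

Definition SU2 (R : realType) : Type :=
  {A : 'M[R[i]]_2 | (A \is unitarymx) && (\det A == 1)}.

Definition U1 (R : realType) : Type := {z : R[i] | `|z| == 1}.

Definition K (R : realType) : Type := (SU2 R * U1 R)%type.

Lemma SU2_mul_subproof (R : realType) (A B : SU2 R) :
  (sval A *m sval B \is unitarymx) && (\det (sval A *m sval B) == 1).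
Proof.
case: A B => [A /= /andP[uA /eqP dA]] [B /= /andP[uB /eqP dB]].
by rewrite mul_unitarymx // det_mulmx dA dB mulr1 eqxx.
Qed.

Definition SU2_mul (R : realType) (A B : SU2 R) : SU2 R :=
  exist _ (sval A *m sval B) (SU2_mul_subproof A B).

Lemma U1_mul_subproof (R : realType) (z w : U1 R) : `|sval z * sval w| == 1.
Proof.
by case: z w => [z /= /eqP nz] [w /= /eqP nw]; rewrite normrM nz nw mulr1.
Qed.

Definition U1_mul (R : realType) (z w : U1 R) : U1 R :=
  exist _ (sval z * sval w) (U1_mul_subproof z w).

Lemma U1_one_subproof (R : realType) : `|1 : R[i]| == 1.
Proof. by rewrite normr1. Qed.

Definition U1_one (R : realType) : U1 R := exist _ 1 (U1_one_subproof R).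

Lemma SU2_one_subproof (R : realType) :
  ((1%:M : 'M[R[i]]_2) \is unitarymx) && (\det (1%:M : 'M[R[i]]_2) == 1).
Proof.
rewrite det1 eqxx andbT; apply/unitarymxP.
by rewrite trmx1 map_mx1 mulmx1.
Qed.

Definition SU2_one (R : realType) : SU2 R := exist _ 1%:M (SU2_one_subproof R).

Definition K_mul (R : realType) (h k : K R) : K R :=
  (SU2_mul h.1 k.1, U1_mul h.2 k.2).

(* The quaternion a + b i + c j + d k as a complex 2 x 2 matrix. *)
Definition quat (R : realType) (a b c d : R) : 'M[R[i]]_2 :=
  \matrix_(r < 2, s < 2)
    if r == 0 then (if s == 0 then Complex a b else Complex c d)
    else (if s == 0 then Complex (- c) d else Complex a (- b)).

Lemma quat_SU2 (R : realType) (a b c d : R) :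
  a ^+ 2 + b ^+ 2 + c ^+ 2 + d ^+ 2 = 1 ->
  (quat a b c d \is unitarymx) && (\det (quat a b c d) == 1).
Proof.
move=> h; apply/andP; split.
  apply/unitarymxP/matrixP => r s.
  case: r => -[|[|//]] lr; case: s => -[|[|//]] ls;
  rewrite !mxE !big_ord_recl big_ord0 !mxE /=;
  (apply/eqP; rewrite eq_complex /=; apply/andP; split; apply/eqP;
   rewrite -?h; ring).
rewrite (expand_det_row _ 0) !big_ord_recl big_ord0 /cofactor !det_mx11 !mxE /=
  /bump /= eq_complex /=.
by apply/andP; split; apply/eqP; [rewrite -[RHS]h|]; ring.
Qed.

(* v_1, v_2, v_3 are the left-invariant fields of -i/2, -j/2, -k/2 in su(2);
   this is the normalisation with [v_1, v_2] = - v_3 and its cyclic images. *)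
Definition su2_basis (R : realType) (j : nat) : 'M[R[i]]_2 :=
  quat 0 (- (j == 1%N)%:R / 2) (- (j == 2)%:R / 2) (- (j == 3)%:R / 2).

Lemma su2_basis_comm (R : realType) :
  let A := @su2_basis R in
  [/\ A 2%N *m A 3%N - A 3%N *m A 2%N = - A 1%N,
      A 3%N *m A 1%N - A 1%N *m A 3%N = - A 2%N
    & A 1%N *m A 2%N - A 2%N *m A 1%N = - A 3%N].
Proof.
split; apply/matrixP => r s;
case: r => -[|[|//]] lr; case: s => -[|[|//]] ls;
rewrite !mxE !big_ord_recl !big_ord0 !mxE /=;
(apply/eqP; rewrite eq_complex /=; apply/andP; split; apply/eqP; lra).
Qed.

(* exp (t A_j) = cos (t/2) + 2 sin (t/2) A_j, since (2 A_j)^2 = -1. *)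
Definition su2_exp_mx (R : realType) (j : nat) (t : R) : 'M[R[i]]_2 :=
  quat (cos (t / 2)) (- (sin (t / 2) * (j == 1%N)%:R))
       (- (sin (t / 2) * (j == 2)%:R)) (- (sin (t / 2) * (j == 3)%:R)).

Lemma su2_exp_subproof (R : realType) (j : 'I_3) (t : R) :
  (su2_exp_mx j.+1 t \is unitarymx) && (\det (su2_exp_mx j.+1 t) == 1).
Proof.
apply: quat_SU2; rewrite -[RHS](cos2Dsin2 (t / 2)).
by case: j => -[|[|[|//]]] lj /=; ring.
Qed.

Definition SU2_exp (R : realType) (j : 'I_3) (t : R) : SU2 R :=
  exist _ (su2_exp_mx j.+1 t) (su2_exp_subproof j t).

Lemma U1_exp_subproof (R : realType) (t : R) : `|Complex (cos t) (sin t)| == 1.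
Proof. by rewrite normc_def /= cos2Dsin2 sqrtr1. Qed.

Definition U1_exp (R : realType) (t : R) : U1 R :=
  exist _ (Complex (cos t) (sin t)) (U1_exp_subproof t).

(* The index j : 'I_4 stands for v_(j+1): the frame v_1, ..., v_4 is indexed
   from 0, and v_4 generates U(1). *)
Definition i1 : 'I_4 := @Ordinal 4 0 isT.
Definition i2 : 'I_4 := @Ordinal 4 1 isT.
Definition i3 : 'I_4 := @Ordinal 4 2 isT.
Definition i4 : 'I_4 := @Ordinal 4 3 isT.

Definition K_exp (R : realType) (j : 'I_4) (t : R) : K R :=
  if unlift i4 j is Some j' then (SU2_exp j' t, U1_one R)
  else (SU2_one R, U1_exp t).

Definition K_embed (R : realType) (k : K R) : 'M[R[i]^o]_2 * R[i]^o :=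
  (sval k.1, sval k.2).

Definition lder (R : realType) (j : 'I_4) (f : K R -> R) : K R -> R :=
  fun k => derive1 (fun t : R => f (K_mul k (K_exp j t))) 0.

(* Since v_1, ..., v_4 is a global frame, f is C^oo iff all its iterated
   derivatives along the frame exist and are continuous. *)
Definition smooth (R : realType) (f : K R -> R) : Prop :=
  forall s : seq 'I_4, let g := foldr (@lder R) f s in
    continuous (g : initial_topology (@K_embed R) -> R) /\
    forall (j : 'I_4) (k : K R),
      derivable (fun t : R => g (K_mul k (K_exp j t))) 0 1.

(* The left-invariant frame and its dual identify each T_k K and T*_k K with
   'rV[R]_4; left-invariant fields and forms are the constant functions. *)
Definition vfield (R : realType) : Type := K R -> 'rV[R]_4.
Definition oneform (R : realType) : Type := K R -> 'rV[R]_4.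

Definition frame (R : realType) (j : 'I_4) : 'rV[R]_4 := delta_mx 0 j.

Definition ev (R : realType) (xi v : 'rV[R]_4) : R := \sum_j xi 0 j * v 0 j.

Definition vder (R : realType) (X : vfield R) (f : K R -> R) : K R -> R :=
  fun k => \sum_j X k 0 j * lder j f k.

(* [v_i, v_j] = \sum_m struct_const i j m v_m *)
Definition struct_const (R : realType) (i j m : 'I_4) : R :=
  ((j, i, m) \in [:: (i1, i2, i3); (i2, i3, i1); (i3, i1, i2)])%:R
  - ((i, j, m) \in [:: (i1, i2, i3); (i2, i3, i1); (i3, i1, i2)])%:R.

Definition lie_bracket (R : realType) (X Y : vfield R) : vfield R :=
  fun k => \row_m (vder X (fun h => Y h 0 m) k - vder Y (fun h => X h 0 m) k
    + \sum_i \sum_j struct_const R i j m * X k 0 i * Y k 0 j).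

Definition lie_form (R : realType) (X : vfield R) (eta : oneform R)
    (Z : vfield R) : K R -> R :=
  fun k => vder X (fun h => ev (eta h) (Z h)) k - ev (eta k) (lie_bracket X Z k).

Definition ext_der (R : realType) (xi : oneform R) (Y Z : vfield R) : K R -> R :=
  fun k => vder Y (fun h => ev (xi h) (Z h)) k
    - vder Z (fun h => ev (xi h) (Y h)) k - ev (xi k) (lie_bracket Y Z k).

Definition fiber (R : realType) : Type := ('rV[R]_4 * 'rV[R]_4)%type.
Definition section (R : realType) : Type := K R -> fiber R.

Definition pairing (R : realType) (a b : fiber R) : R :=
  (ev a.2 b.1 + ev b.2 a.1) / 2.

(* The differential of the projection K -> SU(2), which kills v_4. *)
Definition dproj (R : realType) (v : 'rV[R]_4) : 'rV[R]_3 :=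
  \row_(j < 3) v 0 (lift i4 j).

Definition Hform (R : realType) (l : R) (X Y Z : 'rV[R]_4) : R :=
  l * \det (\matrix_(a < 3) tnth [tuple dproj X; dproj Y; dproj Z] a).

Definition dorfman (R : realType) (l : R) (a b : section R) : section R :=
  let X k := (a k).1 in let xi k := (a k).2 in
  let Y k := (b k).1 in let eta k := (b k).2 in
  fun k => (lie_bracket X Y k,
    \row_m (lie_form X eta (fun=> frame R m) k
            - ext_der xi Y (fun=> frame R m) k
            + Hform l (X k) (Y k) (frame R m))).

Definition metric (R : realType) (l x : R) : 'M[R]_4 :=
  l *: diag_mx (\row_j if j == i4 then x ^+ 2 else 1).

Definition flat (R : realType) (l x : R) (v : 'rV[R]_4) : 'rV[R]_4 :=
  v *m metric l x.

Definition Vplus (R : realType) (l x : R) : set (fiber R) :=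
  [set a | a.2 = flat l x a.1].

Definition volume (R : realType) (l x : R) (Y : 'I_4 -> vfield R) : K R -> R :=
  fun k => Num.sqrt (\det (metric l x)) * \det (\matrix_i Y i k).

Definition lie_volume (R : realType) (l x : R) (X : vfield R)
    (Y : 'I_4 -> vfield R) : K R -> R :=
  fun k => vder X (volume l x Y) k
    - \sum_i volume l x (fun j => if j == i then lie_bracket X (Y i) else Y j) k.

Definition div0 (R : realType) (l x : R) (a : section R) : K R -> R :=
  let Y j := (fun=> frame R j) : vfield R in
  fun k => lie_volume l x (fun h => (a h).1) Y k / volume l x Y k.

Definition epsilon (R : realType) (x : R) : fiber R := (0, - x *: frame R i4).

Definition divplus (R : realType) (l x : R) (a : section R) : K R -> R :=
  fun k => div0 l x a k - pairing (epsilon x) (a k).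

(* Row-vector convention: I_x v = v *m acs x. The values on v_1 and v_3 are
   forced by I_x^2 = -1. *)
Definition acs (R : realType) (x : R) : 'M[R]_4 :=
  \matrix_j if j == i4 then x *: frame R i1
            else if j == i1 then - x^-1 *: frame R i4
            else if j == i2 then frame R i3
            else - frame R i2.

Definition Iplus (R : realType) (l x : R) (a : fiber R) : fiber R :=
  (a.1 *m acs x, flat l x (a.1 *m acs x)).

(* A left-invariant spinor is an element of a fixed module S of the complex
   Clifford algebra of the typical fibre V (rank 4), with v^2 = <v, v>; up to
   isomorphism there is exactly one such S of complex dimension 4. *)
Definition clifford_action (R : realType) (V : set (fiber R))
    (rho : fiber R -> 'M[R[i]]_4) : Prop :=
  (forall (c : R) a b, V a -> V b ->
     rho (c *: a + b) = (Complex c 0) *: rho a + rho b) /\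
  (forall a, V a -> rho a *m rho a = (Complex (pairing a a) 0)%:M).

(* An element a + i b of the complexification of V is an eigenvector of I
   for +i iff I a = - b and I b = a. *)
Definition pure_spinor (R : realType) (V : set (fiber R))
    (I : fiber R -> fiber R) (rho : fiber R -> 'M[R[i]]_4)
    (eta : 'cV[R[i]]_4) : Prop :=
  eta <> 0 /\
  forall a b, V a -> V b -> I a = - b -> I b = a ->
    (rho a + (Complex 0 1) *: rho b) *m eta = 0.

Record triple (R : realType) : Type := Triple {
  tV : set (fiber R);
  tdiv : section R -> K R -> R;
  (* the complex structure on tV corresponding to the line of tspinor *)
  tI : fiber R -> fiber R;
  tact : fiber R -> 'M[R[i]]_4;
  tspinor : 'cV[R[i]]_4
}.

Definition triple_at (R : realType) (l x : R) (rho : fiber R -> 'M[R[i]]_4)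
    (eta : 'cV[R[i]]_4) : triple R :=
  {| tV := Vplus l x; tdiv := divplus l x; tI := Iplus l x;
     tact := rho; tspinor := eta |}.

Definition T1_act (R : realType) (k : K R) (s : U1 R) : K R :=
  K_mul k (SU2_one R, s).

(* U(1) is central, so right translations by it preserve the left-invariant
   frame, and a section is T^1-invariant iff its components are. *)
Definition T1_invariant (R : realType) (T : Type) (f : K R -> T) : Prop :=
  forall k s, f (T1_act k s) = f k.

(* The sections of E_l / T^1 that take values in V. *)
Definition red_sections (R : realType) (V : set (fiber R)) : set (section R) :=
  [set a : section R | [/\ T1_invariant a,
               forall j, smooth (fun k => (a k).1 0 j),
               forall j, smooth (fun k => (a k).2 0 j)
             & forall k, V (a k)]].

(* The fibre product of K and its second copy over SU(2). *)
Record Kbar (R : realType) : Type := MkKbar {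
  q : K R;
  qhat : K R;
  Kbar_fiber : q.1 = qhat.1
}.

Lemma Kbar_act_subproof (R : realType) (z : Kbar R) (s t : U1 R) :
  (T1_act (q z) s).1 = (T1_act (qhat z) t).1.
Proof. by rewrite /= (Kbar_fiber z). Qed.

Definition Kbar_act (R : realType) (z : Kbar R) (s t : U1 R) : Kbar R :=
  MkKbar (Kbar_act_subproof z s t).

(* The tangent spaces of Kbar are the fibre products of those of the two
   factors: pairs (q_* Y, qhat_* Y) with the same image in T SU(2). *)
Definition Kbar_tangent (R : realType) : set ('rV[R]_4 * 'rV[R]_4) :=
  [set Y | dproj Y.1 = dproj Y.2].

Definition Bbar (R : realType) (X Y : 'rV[R]_4 * 'rV[R]_4) : R :=
  - (X.1 0 i4 * Y.2 0 i4 - Y.1 0 i4 * X.2 0 i4).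

Definition T_dual_lift (R : realType) (a : section R)
    (X : Kbar R -> 'rV[R]_4 * 'rV[R]_4) : Prop :=
  [/\ forall z, Kbar_tangent (X z),
      forall z s t, X (Kbar_act z s t) = X z,
      forall z, (X z).1 = (a (q z)).1
    & forall z c, let Y := (c *: frame R i4, 0) in
        ev (a (q z)).2 Y.1 - Bbar (X z) Y = 0].

Definition T_dual_section (R : realType) (a b : section R) : Prop :=
  exists2 X : Kbar R -> 'rV[R]_4 * 'rV[R]_4, T_dual_lift a X &
    forall z, (b (qhat z)).1 = (X z).2 /\
      forall Y, Kbar_tangent Y ->
        ev (b (qhat z)).2 Y.2 = ev (a (q z)).2 Y.1 - Bbar (X z) Y.

Definition psi (R : realType) (a : section R) : section R :=
  xget (0 : K R -> 'rV[R]_4 * 'rV[R]_4) [set b | T_dual_section a b].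

Definition reduced_courant_iso (R : realType) (l : R)
    (f : section R -> section R) : Prop :=
  let Gamma := red_sections [set: fiber R] in
  set_bij Gamma Gamma f /\
  forall a b, Gamma a -> Gamma b ->
  [/\ forall u : SU2 R -> R, smooth (fun k => u k.1) ->
        f (fun k => u k.1 *: a k + b k) = (fun k => u k.1 *: f a k + f b k),
      forall z, dproj (f a (qhat z)).1 = dproj (a (q z)).1,
      forall z, pairing (f a (qhat z)) (f b (qhat z)) =
                pairing (a (q z)) (b (q z))
    & f (dorfman l a b) = dorfman l (f a) (f b)].

Definition exchanged_under_T_duality (R : realType) (l : R)
    (t that : triple R) : Prop :=
  [/\ reduced_courant_iso l (@psi R),
      @psi R @` red_sections (tV t) = red_sections (tV that),
      forall a, red_sections (tV t) a ->
        forall z, tdiv that (psi a) (qhat z) = tdiv t a (q z),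
      forall a, red_sections (tV t) a ->
        psi (fun k => tI t (a k)) = (fun k => tI that (psi a k))
    & exists2 P : 'M[R[i]]_4, P \in unitmx &
        (forall a k, tV t a ->
           P *m tact t a = tact that (psi (fun=> a) k) *m P) /\
        exists2 c : R[i], c != 0 & P *m tspinor t = c *: tspinor that].

(* Main.v *)
Require Import Defs.
From mathcomp Require Import all_boot all_order all_algebra.
From mathcomp Require Import complex.
From mathcomp Require Import all_classical all_reals all_analysis.
From mathcomp Require Import ring lra.
Import Order.TTheory GRing.Theory Num.Theory numFieldNormedType.Exports.
Local Open Scope ring_scope.

Set Implicit Arguments.
Unset Strict Implicit.
Unset Printing Implicit Defensive.

(** In the left-invariant frame, T-duality along U(1) is an exchange of
    coefficients.  The condition that selects the lift of X says that its
    component along the dual circle is the v^4-coefficient of xi, and the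
    form that then descends has the v_4-coefficient of X as its new
    v^4-coefficient.  So psi acts on invariant sections by the constant linear
    involution [fswap] of the fibre that exchanges the coefficients of v_4 and
    v^4 ([psiE]); everything below is about this one map.

    It is an isometry, because the pairing is symmetric in v_4 and v^4.  It
    respects the Dorfman bracket ([dorfman_sswap]) because an invariant
    function is not differentiated along v_4, while the structure constants
    and H only involve v_1, v_2, v_3; the one term that mixes derivatives
    along different directions is a pairing of one section with a derivative
    of the other, so it is preserved by isometry, and both v_4- and
    v^4-coefficients of the bracket reduce to the same expression
    D_X (-) - D_Y (-).

    On V_+ the form part is g_x of the vector part, so in the direction of v_4
    the swap turns the slope l x^2 into 1 / (l x^2) = l xhat^2.  This single
    identity, with l x xhat = 1, gives the statements on V_+, on the
    divergence (div_0 is the plain sum of the derivatives D_i X_i, whose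
    fourth term vanishes, and the epsilon term only sees the coefficient of
    v_4) and on the complex structure.

    For the spinors, transport both Clifford modules to V_+^x.  A pure spinor
    for I_x is a vacuum: it is killed by the operators r v - i r (I_x v).
    Together with the opposite operators r v + i r (I_x v) these satisfy the
    canonical anticommutation relations, and a vacuum in dimension 4 generates
    a basis in which all operators have matrices that do not depend on the
    module.  Matching the two bases gives the intertwiner, and it sends vacuum
    to vacuum ([pure_spinor_unique]). *)

(** * Invariant functions and their derivatives along the frame *)

Lemma sum_I4 (V : nmodType) (F : 'I_4 -> V) :
  \sum_i F i = F i1 + F i2 + F i3 + F i4.
Proof.
rewrite !big_ord_recl big_ord0 addr0 !addrA.
by congr (F _ + F _ + F _ + F _); apply: val_inj.
Qed.

Lemma I4_cases (P : 'I_4 -> Prop) : P i1 -> P i2 -> P i3 -> P i4 -> forall i, P i.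
Proof.
move=> p1 p2 p3 p4 [[|[|[|[|//]]]] lt_i4]; by rewrite (bool_irrelevance lt_i4 isT).
Qed.

Lemma K_eq (R : realType) (h k : K R) :
  sval h.1 = sval k.1 -> sval h.2 = sval k.2 -> h = k.
Proof.
by case: h k => [h1 h2] [k1 k2] /= e1 e2; congr pair; apply: val_inj.
Qed.

Lemma T1_act_fst (R : realType) (k : K R) s : (T1_act k s).1 = k.1.
Proof. by apply: val_inj; rewrite /= mulmx1. Qed.

(** Two points over the same point of SU(2) differ by the quotient of their
    phases. *)
Lemma T1_act_transitive (R : realType) (h k : K R) :
  h.1 = k.1 -> exists s, h = T1_act k s.
Proof.
move=> e1.
have nz : `|(sval k.2)^* * sval h.2| == 1.
  by rewrite normrM norm_conjC (eqP (svalP k.2)) (eqP (svalP h.2)) mulr1.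
exists (exist (fun z : R[i] => `|z| == 1) _ nz); apply: K_eq.
  by rewrite T1_act_fst e1.
by rewrite /= mulrA -normCK (eqP (svalP k.2)) expr1n mul1r.
Qed.

Lemma T1_invariant_fiber (R : realType) (T : Type) (f : K R -> T) :
  T1_invariant f -> forall h k : K R, h.1 = k.1 -> f h = f k.
Proof. by move=> fI h k /T1_act_transitive [s ->]; rewrite fI. Qed.

Lemma K_exp0 (R : realType) (k : K R) j : K_mul k (K_exp j 0) = k.
Proof.
apply: K_eq; rewrite /K_exp; case: unliftP => [j' _|_] /=; rewrite ?mulmx1 ?mulr1 //.
  have -> : su2_exp_mx j'.+1 0 = 1%:M :> 'M[R[i]]_2.
    rewrite /su2_exp_mx mul0r cos0 sin0; apply/matrixP => r s.
    by case: r => -[|[|//]] lr; case: s => -[|[|//]] ls;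
       rewrite !mxE /= !mul0r ?oppr0.
  by rewrite mulmx1.
by rewrite cos0 sin0 [Complex 1 0](_ : _ = 1) ?mulr1.
Qed.

(** U(1) is central in K, so its action commutes with the flows of the frame;
    derivatives of invariant functions are therefore invariant. *)
Lemma T1_actC (R : realType) (k : K R) s j t :
  K_mul (T1_act k s) (K_exp j t) = T1_act (K_mul k (K_exp j t)) s.
Proof.
by apply: K_eq; rewrite /= ?mulmx1 // -!mulrA; congr (_ * _); rewrite mulrC.
Qed.

Lemma lder_T1_invariant (R : realType) (f : K R -> R) j :
  T1_invariant f -> T1_invariant (lder j f).
Proof.
move=> fI k s; rewrite /lder; congr (derive1 _ 0); apply/funext => t.
by rewrite T1_actC fI.
Qed.

Lemma lder_cst (R : realType) (c : R) j : lder j (fun=> c) = fun=> 0.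
Proof. by apply/funext => k; rewrite /lder derive1_cst. Qed.

(** The flow of v_4 moves along the orbits of U(1). *)
Lemma lder_i4 (R : realType) (f : K R -> R) :
  T1_invariant f -> lder i4 f = fun=> 0.
Proof.
move=> fI; apply/funext => k; rewrite /lder.
rewrite (_ : (fun t => _) = cst (f k)) ?derive1_cst //.
apply/funext => t /=; apply: T1_invariant_fiber => //=.
by rewrite /K_exp unlift_none; apply: val_inj; rewrite /= mulmx1.
Qed.

Definition fderivable (R : realType) (f : K R -> R) : Prop :=
  forall j k, derivable (fun t : R => f (K_mul k (K_exp j t))) 0 1.

Lemma smooth_fderivable (R : realType) (f : K R -> R) : smooth f -> fderivable f.
Proof. by move=> /(_ [::]) [_ df] j k; apply: df. Qed.

Lemma lder_ev (R : realType) (xi : oneform R) (Y : vfield R) j k :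
  (forall n, fderivable (fun h => xi h 0 n)) ->
  (forall n, fderivable (fun h => Y h 0 n)) ->
  lder j (fun h => ev (xi h) (Y h)) k =
  \sum_n (lder j (fun h => xi h 0 n) k * Y k 0 n +
          xi k 0 n * lder j (fun h => Y h 0 n) k).
Proof.
move=> dxi dY; rewrite /lder derive1E.
pose g n t := xi (K_mul k (K_exp j t)) 0 n * Y (K_mul k (K_exp j t)) 0 n.
rewrite (_ : (fun t => _) = \sum_n g n); last first.
  by apply/funext => t; rewrite fct_sumE.
rewrite derive_sum; last by move=> n; apply: derivableM; [exact: dxi | exact: dY].
apply: eq_bigr => n _; rewrite !derive1E.
have := deriveM (dxi n j k) (dY n j k).
rewrite /g => ->; rewrite !K_exp0 /GRing.scale /= addrC; congr (_ + _).
by rewrite mulrC.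
Qed.

(** * The Dorfman bracket in the frame *)

Lemma vder_cst (R : realType) (X : vfield R) (c : R) k : vder X (fun=> c) k = 0.
Proof. by rewrite /vder big1 // => j _; rewrite lder_cst mulr0. Qed.

Lemma vder_frame (R : realType) (f : K R -> R) m k :
  vder (fun=> frame R m) f k = lder m f k.
Proof.
rewrite /vder (bigD1 m) //= mxE !eqxx mul1r big1 ?addr0 // => j jm.
by rewrite mxE (negPf jm) mul0r.
Qed.

Lemma ev_frame (R : realType) (xi : 'rV[R]_4) m : ev xi (frame R m) = xi 0 m.
Proof.
rewrite /ev (bigD1 m) //= mxE !eqxx mulr1 big1 ?addr0 // => j jm.
by rewrite mxE (negPf jm) mulr0.
Qed.

(** The constant-coefficient part of xi([X, v_m]), i.e. minus the coadjoint
    action of X on xi. *)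
Definition coframe_bracket (R : realType) (X xi : 'rV[R]_4) m : R :=
  \sum_i \sum_n struct_const R i m n * X 0 i * xi 0 n.

Lemma ev_lie_bracket_frame (R : realType) (xi : 'rV[R]_4) (X : vfield R) m k :
  ev xi (lie_bracket X (fun=> frame R m) k) =
  coframe_bracket (X k) xi m - \sum_n xi 0 n * lder m (fun h => X h 0 n) k.
Proof.
rewrite /ev /coframe_bracket exchange_big /= -sumrB; apply: eq_bigr => n _.
rewrite mxE vder_cst vder_frame sub0r mulrDr mulrN addrC; congr (_ - _).
rewrite mulr_sumr; apply: eq_bigr => i _.
rewrite (bigD1 m) //= mxE !eqxx mulr1 big1 ?addr0 1?mulrC // => j jm.
by rewrite mxE (negPf jm) !mulr0.
Qed.

Lemma lie_form_frame (R : realType) (X : vfield R) (eta : oneform R) m k :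
  lie_form X eta (fun=> frame R m) k =
  vder X (fun h => eta h 0 m) k - coframe_bracket (X k) (eta k) m
  + \sum_n eta k 0 n * lder m (fun h => X h 0 n) k.
Proof.
rewrite /lie_form ev_lie_bracket_frame opprB addrA addrAC.
congr (_ - _ + _).
by congr vder; apply/funext => h; rewrite ev_frame.
Qed.

Lemma ext_der_frame (R : realType) (xi : oneform R) (Y : vfield R) m k :
  (forall n, fderivable (fun h => xi h 0 n)) ->
  (forall n, fderivable (fun h => Y h 0 n)) ->
  ext_der xi Y (fun=> frame R m) k =
  vder Y (fun h => xi h 0 m) k - coframe_bracket (Y k) (xi k) m
  - \sum_n lder m (fun h => xi h 0 n) k * Y k 0 n.
Proof.
move=> dxi dY.
rewrite /ext_der ev_lie_bracket_frame vder_frame lder_ev // big_split /=.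
rewrite (_ : (fun h => ev _ _) = (fun h => xi h 0 m)); first by ring.
by apply/funext => h; rewrite ev_frame.
Qed.

(** * T-duality exchanges the coefficients of v_4 and v^4 *)

Definition fswap (R : realType) (a : fiber R) : fiber R :=
  (\row_j if j == i4 then a.2 0 j else a.1 0 j,
   \row_j if j == i4 then a.1 0 j else a.2 0 j).

Definition sswap (R : realType) (a : section R) : section R :=
  fun k => fswap (a k).

Lemma fswapK (R : realType) : involutive (@fswap R).
Proof.
by case=> v xi; rewrite /fswap; congr pair; apply/rowP => j; rewrite !mxE;
  case: (j == i4).
Qed.

Lemma sswapK (R : realType) : involutive (@sswap R).
Proof. by move=> a; apply/funext => k; apply: fswapK. Qed.

Lemma fswap_linear (R : realType) (c : R) (a b : fiber R) :
  fswap (c *: a + b) = c *: fswap a + fswap b.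
Proof.
case: a b => [v xi] [w eta]; rewrite /fswap; congr pair; apply/rowP => j;
by rewrite !mxE; case: (j == i4).
Qed.

Lemma dproj_fswap (R : realType) (a : fiber R) : dproj (fswap a).1 = dproj a.1.
Proof.
by apply/rowP => j; rewrite !mxE eq_sym (negPf (neq_lift _ _)).
Qed.

Lemma pairing_fswap (R : realType) (a b : fiber R) :
  pairing (fswap a) (fswap b) = pairing a b.
Proof.
rewrite /pairing /ev; congr (_ / _); rewrite -!big_split /=.
apply: eq_bigr => j _; rewrite !mxE; case: eqP => _ //.
by rewrite addrC; congr (_ + _); rewrite mulrC.
Qed.

Lemma T1_invariant_sswap (R : realType) (a : section R) :
  T1_invariant a -> T1_invariant (sswap a).
Proof. by move=> aI k s; rewrite /sswap aI. Qed.

Lemma sswap_fst (R : realType) (a : section R) j :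
  (fun k => (sswap a k).1 0 j) =
  if j == i4 then fun k => (a k).2 0 j else fun k => (a k).1 0 j.
Proof. by apply/funext => k; rewrite mxE; case: (j == i4). Qed.

Lemma sswap_snd (R : realType) (a : section R) j :
  (fun k => (sswap a k).2 0 j) =
  if j == i4 then fun k => (a k).1 0 j else fun k => (a k).2 0 j.
Proof. by apply/funext => k; rewrite mxE; case: (j == i4). Qed.

Lemma sswap_components (R : realType) (P : (K R -> R) -> Prop) (a : section R) :
  (forall j, P (fun k => (a k).1 0 j)) -> (forall j, P (fun k => (a k).2 0 j)) ->
  (forall j, P (fun k => (sswap a k).1 0 j)) /\
  (forall j, P (fun k => (sswap a k).2 0 j)).
Proof.
by move=> P1 P2; split=> j; rewrite ?sswap_fst ?sswap_snd; case: (j == i4).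
Qed.

Lemma Kbar_diagonal (R : realType) (k : K R) : exists2 z : Kbar R, q z = k & qhat z = k.
Proof. by exists (MkKbar (erefl k.1)). Qed.

(** The dual section is determined: the diagonal meets every fibre of qhat,
    the lift condition fixes the fourth component of the lift, and testing the
    descended form on the vectors (v_j, v_j) reads off its coefficients. *)
Lemma T_dual_section_eq (R : realType) (a b : section R) :
  T_dual_section a b -> b = sswap a.
Proof.
move=> [X [Xt Xinv X1 Xh] Xb]; apply/funext => k.
have [z qz qhz] := Kbar_diagonal k.
have [b1 b2] := Xb z; rewrite qz qhz in b1 b2; have := X1 z; rewrite qz => X1z.
have X4 : (X z).2 0 i4 = (a k).2 0 i4.
  have := Xh z 1; rewrite /= scale1r qz ev_frame /Bbar /= !mxE !eqxx.
  by move=> /eqP; rewrite mulr0 sub0r mul1r opprK subr_eq0 => /eqP.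
have Xj j : j != i4 -> (X z).2 0 j = (a k).1 0 j.
  move=> ji4; have := Xt z; rewrite /Kbar_tangent /= X1z.
  by case: (unliftP i4 j) ji4 => [j' -> _|-> /eqP//] /rowP/(_ j'); rewrite !mxE.
rewrite /sswap /fswap [b k]surjective_pairing; congr pair; apply/rowP => j.
  by rewrite b1 mxE; case: eqVneq => [->|/Xj].
have := b2 (frame R j, frame R j) erefl.
rewrite /= !ev_frame => ->; rewrite /Bbar /= X1z X4 !mxE eqxx /= [i4 == j]eq_sym.
by case: eqVneq => [->|_]; rewrite ?mulr1n ?mulr0n; ring.
Qed.

(** Away from the diagonal, invariance identifies the values of a at q z and
    at qhat z, which lie on the same U(1)-orbit. *)
Lemma T_dual_sswap (R : realType) (a : section R) :
  T1_invariant a -> T_dual_section a (sswap a).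
Proof.
move=> aI.
have az z : a (qhat z) = a (q z).
  by apply: T1_invariant_fiber => //; rewrite Kbar_fiber.
exists (fun z => ((a (q z)).1, (sswap a (q z)).1)).
  split=> //.
  - by move=> z; rewrite /Kbar_tangent /= dproj_fswap.
  - by move=> z s t; rewrite /sswap /= aI.
  - move=> z c /=; rewrite /Bbar /= /ev sum_I4 !mxE /=.
    ring.
move=> z; rewrite /sswap az; split=> // -[Y1 Y2]; rewrite /Kbar_tangent /= => Yt.
have Yj (j : 'I_4) : j != i4 -> Y1 0 j = Y2 0 j.
  move=> ji4; move: Yt.
  by case: (unliftP i4 j) ji4 => [j' -> _|-> /eqP//] /rowP/(_ j'); rewrite !mxE.
rewrite /ev !sum_I4 /Bbar /= !mxE /= (Yj i1) // (Yj i2) // (Yj i3) //; ring.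
Qed.

Lemma psiE (R : realType) (a : section R) : T1_invariant a -> psi a = sswap a.
Proof.
by move=> /T_dual_sswap aT; apply: T_dual_section_eq; apply: xgetPex;
  exists (sswap a).
Qed.

(** * T-duality preserves the Dorfman bracket *)

Definition lder_fiber (R : realType) (a : section R) j k : fiber R :=
  (\row_n lder j (fun h => (a h).1 0 n) k, \row_n lder j (fun h => (a h).2 0 n) k).

Lemma lder_fiber_sswap (R : realType) (a : section R) j k :
  lder_fiber (sswap a) j k = fswap (lder_fiber a j k).
Proof.
by rewrite /lder_fiber /fswap; congr pair; apply/rowP => n;
  rewrite !mxE ?sswap_fst ?sswap_snd; case: (n == i4).
Qed.

Definition vder_fiber (R : realType) (X : vfield R) (a : section R) k : fiber R :=
  (\row_n vder X (fun h => (a h).1 0 n) k, \row_n vder X (fun h => (a h).2 0 n) k).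

Lemma vder_fiberE (R : realType) (X : vfield R) (a : section R) k :
  vder_fiber X a k = \sum_j X k 0 j *: lder_fiber a j k.
Proof.
rewrite [RHS]surjective_pairing !raddf_sum.
by congr pair; apply/rowP => n; rewrite mxE summxE; apply: eq_bigr => j _; rewrite !mxE.
Qed.

Lemma struct_const4l (R : realType) j m : struct_const R i4 j m = 0.
Proof. by rewrite /struct_const !inE !xpair_eqE /= !andbF /= subrr. Qed.

Lemma struct_const4m (R : realType) i m : struct_const R i i4 m = 0.
Proof. by rewrite /struct_const !inE !xpair_eqE /= !andbF /= subrr. Qed.

Lemma struct_const4r (R : realType) i j : struct_const R i j i4 = 0.
Proof. by rewrite /struct_const !inE !xpair_eqE /= !andbF /= subrr. Qed.

Definition su2_bracket (R : realType) (X Y : 'rV[R]_4) m : R :=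
  \sum_i \sum_j struct_const R i j m * X 0 i * Y 0 j.

Lemma su2_bracket_fswap (R : realType) (a b : fiber R) m :
  su2_bracket (fswap a).1 (fswap b).1 m = su2_bracket a.1 b.1 m.
Proof.
apply: eq_bigr => i _; apply: eq_bigr => j _; rewrite !mxE.
by case: eqVneq => [->|_]; [by rewrite struct_const4l !mul0r|];
   case: eqVneq => [->|_]; rewrite ?struct_const4m ?mul0r.
Qed.

Lemma su2_bracket4 (R : realType) (X Y : 'rV[R]_4) : su2_bracket X Y i4 = 0.
Proof.
by apply: big1 => i _; apply: big1 => j _; rewrite struct_const4r !mul0r.
Qed.

Lemma coframe_bracket_fswap (R : realType) (a b : fiber R) m :
  coframe_bracket (fswap a).1 (fswap b).2 m = coframe_bracket a.1 b.2 m.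
Proof.
apply: eq_bigr => i _; apply: eq_bigr => j _; rewrite !mxE.
by case: eqVneq => [->|_]; [by rewrite struct_const4l !mul0r|];
   case: eqVneq => [->|_]; rewrite ?struct_const4r ?mul0r.
Qed.

Lemma coframe_bracket4 (R : realType) (X xi : 'rV[R]_4) :
  coframe_bracket X xi i4 = 0.
Proof.
by apply: big1 => i _; apply: big1 => j _; rewrite struct_const4m !mul0r.
Qed.

Lemma Hform4 (R : realType) l (X Y : 'rV[R]_4) : Hform l X Y (frame R i4) = 0.
Proof.
rewrite /Hform (expand_det_row _ (@Ordinal 3 2 isT)) big1 ?mulr0 // => j _.
rewrite mxE /= (tnth_nth 0) /= !mxE.
by rewrite [lift _ _ == _]eq_sym (negPf (neq_lift _ _)) mul0r.
Qed.

Lemma Hform_fswap (R : realType) l (a b : fiber R) Z :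
  Hform l (fswap a).1 (fswap b).1 Z = Hform l a.1 b.1 Z.
Proof. by rewrite /Hform !dproj_fswap. Qed.

(** The part of the bracket other than the two derivatives along the anchors:
    the first slot is algebraic, and the second slot also contains the
    derivatives of a along v_m.  Grouping the latter into a pairing makes their
    behaviour under isometries visible. *)
Definition dorfman_tensor (R : realType) (l : R) (a b : section R) k : fiber R :=
  (\row_m su2_bracket (a k).1 (b k).1 m,
   \row_m (coframe_bracket (b k).1 (a k).2 m - coframe_bracket (a k).1 (b k).2 m
     + 2 * pairing (lder_fiber a m k) (b k) + Hform l (a k).1 (b k).1 (frame R m))).

Lemma dorfmanE (R : realType) (l : R) (a b : section R) k :
  (forall n, fderivable (fun h => (a h).2 0 n)) ->
  (forall n, fderivable (fun h => (b h).1 0 n)) ->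
  dorfman l a b k = vder_fiber (fun h => (a h).1) b k
    - vder_fiber (fun h => (b h).1) a k + dorfman_tensor l a b k.
Proof.
move=> da db; rewrite /dorfman [RHS]surjective_pairing /=.
congr pair; apply/rowP => m; rewrite !mxE // lie_form_frame ext_der_frame //.
rewrite /pairing /ev /=.
rewrite mulrCA divff ?mulr1 ?pnatr_eq0 //.
(* t1 and t2 are the two halves of the pairing with lder_fiber a m k. *)
set s1 := \sum_n (b k).2 0 n * _; set s2 := \sum_n _ * (b k).1 0 n.
set t1 := \sum_j _; set t2 := \sum_j _.
have -> : t1 = s2 by apply: eq_bigr => n _; rewrite mxE.
have -> : t2 = s1 by apply: eq_bigr => n _; rewrite mxE.
ring.
Qed.

Lemma lder_fiber4 (R : realType) (a : section R) k :
  T1_invariant a -> lder_fiber a i4 k = 0.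
Proof.
move=> aI; rewrite /lder_fiber; congr pair; apply/rowP => n; rewrite !mxE lder_i4 //;
by move=> h s; rewrite aI.
Qed.

Lemma lder_fiber_T1 (R : realType) (a : section R) j :
  T1_invariant a -> T1_invariant (lder_fiber a j).
Proof.
move=> aI k s; rewrite /lder_fiber; congr pair; apply/rowP => n; rewrite !mxE;
by apply: lder_T1_invariant => h t; rewrite aI.
Qed.

Lemma fswapD (R : realType) (a b : fiber R) : fswap (a + b) = fswap a + fswap b.
Proof. by rewrite -[a]scale1r fswap_linear !scale1r. Qed.

Lemma fswap0 (R : realType) : fswap (0 : fiber R) = 0.
Proof. by apply: (addrI (fswap 0)); rewrite -fswapD !addr0. Qed.

Lemma fswapZ (R : realType) c (a : fiber R) : fswap (c *: a) = c *: fswap a.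
Proof. by rewrite -[c *: a]addr0 fswap_linear fswap0 addr0. Qed.

Lemma fswapN (R : realType) (a : fiber R) : fswap (- a) = - fswap a.
Proof. by rewrite -scaleN1r fswapZ scaleN1r. Qed.

(** The swap changes the coefficient of v_4 in the anchor of b, but an invariant
    section is constant in that direction. *)
Lemma vder_fiber_fswap (R : realType) (a b : section R) k :
  T1_invariant a ->
  vder_fiber (fun h => (sswap b h).1) (sswap a) k =
  fswap (vder_fiber (fun h => (b h).1) a k).
Proof.
move=> aI; rewrite !vder_fiberE (big_morph _ (@fswapD R) (@fswap0 R)).
apply: eq_bigr => j _; rewrite fswapZ lder_fiber_sswap mxE.
by case: eqVneq => [->|//]; rewrite lder_fiber4 // fswap0 !scaler0.
Qed.

(** The components m <> 4 only see coefficients that the swap fixes or the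
    pairing; the components m = 4 all vanish, so exchanging them is harmless. *)
Lemma dorfman_tensor_fswap (R : realType) l (a b : section R) k :
  T1_invariant a ->
  dorfman_tensor l (sswap a) (sswap b) k = fswap (dorfman_tensor l a b k).
Proof.
move=> aI; rewrite /dorfman_tensor; congr pair; apply/rowP => m; rewrite !mxE;
rewrite ?su2_bracket_fswap ?coframe_bracket_fswap ?lder_fiber_sswap
  ?pairing_fswap ?Hform_fswap;
case: eqVneq => [->|//];
by rewrite su2_bracket4 !coframe_bracket4 lder_fiber4 // Hform4 /pairing /ev
  !big1 ?addr0 ?mul0r ?mulr0 ?subrr ?addr0 // => j _ /=; rewrite mxE ?mulr0 ?mul0r.
Qed.

Lemma vder_fiber_T1 (R : realType) (a b : section R) :
  T1_invariant a -> T1_invariant b ->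
  T1_invariant (vder_fiber (fun h => (b h).1) a).
Proof.
by move=> aI bI k s; rewrite !vder_fiberE bI; apply: eq_bigr => j _;
  rewrite lder_fiber_T1.
Qed.

Lemma dorfman_tensor_T1 (R : realType) l (a b : section R) :
  T1_invariant a -> T1_invariant b -> T1_invariant (dorfman_tensor l a b).
Proof.
move=> aI bI k s; rewrite /dorfman_tensor aI bI.
by under [X in (_, X)]eq_mx do rewrite lder_fiber_T1 //.
Qed.

Lemma dorfman_T1_invariant (R : realType) l (a b : section R) :
  (forall n, fderivable (fun h => (a h).2 0 n)) ->
  (forall n, fderivable (fun h => (b h).1 0 n)) ->
  T1_invariant a -> T1_invariant b -> T1_invariant (dorfman l a b).
Proof.
move=> da db aI bI k s.
by rewrite !dorfmanE // !vder_fiber_T1 // dorfman_tensor_T1.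
Qed.

Lemma dorfman_sswap (R : realType) l (a b : section R) :
  (forall n, fderivable (fun h => (a h).1 0 n)) ->
  (forall n, fderivable (fun h => (a h).2 0 n)) ->
  (forall n, fderivable (fun h => (b h).1 0 n)) ->
  (forall n, fderivable (fun h => (b h).2 0 n)) ->
  T1_invariant a -> T1_invariant b ->
  dorfman l (sswap a) (sswap b) = sswap (dorfman l a b).
Proof.
move=> da1 da2 db1 db2 aI bI; apply/funext => k.
have [_ dsa2] := sswap_components da1 da2.
have [dsb1 _] := sswap_components db1 db2.
rewrite (dorfmanE l _ dsa2 dsb1).
rewrite [RHS]/sswap.
rewrite (dorfmanE l _ da2 db1).
rewrite !fswapD fswapN.
rewrite -!vder_fiber_fswap //.
by rewrite dorfman_tensor_fswap.
Qed.

(** * The divergence *)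

Lemma struct_const_diag (R : realType) i m : struct_const R i m m = 0.
Proof.
elim/I4_cases: i; elim/I4_cases: m;
by rewrite /struct_const !inE !xpair_eqE /= subrr.
Qed.

Lemma coframe_bracket_diag (R : realType) (X : 'rV[R]_4) m :
  coframe_bracket X (frame R m) m = 0.
Proof.
apply: big1 => i _; apply: big1 => n _; rewrite mxE /=.
by case: eqVneq => [->|_]; rewrite ?struct_const_diag ?mul0r ?mulr0.
Qed.

(** Expanding along row i, the cofactors are those of the identity matrix,
    since they ignore row i. *)
Lemma det_replace_row (F : comPzRingType) n (v : 'rV[F]_n) (i : 'I_n) :
  \det (\matrix_j (if j == i then v else delta_mx 0 j)) = v 0 i.
Proof.
set M := \matrix_j _.
have cofM j : cofactor M i j = (i == j)%:R.
  have -> : cofactor M i j = cofactor 1%:M i j.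
    rewrite /cofactor; congr (_ * \det _); apply/matrixP => r s.
    by rewrite !mxE eq_sym (negPf (neq_lift _ _)) !mxE eqxx eq_sym.
  have := congr1 (fun A : 'M[F]_n => A j i) (mul_mx_adj (1%:M : 'M[F]_n)).
  by rewrite mul1mx det1 !mxE => ->; rewrite eq_sym.
rewrite (expand_det_row _ i) (bigD1 i) //= cofM eqxx mulr1 !mxE eqxx.
by rewrite big1 ?addr0 // => j ji; rewrite cofM eq_sym (negPf ji) mulr0.
Qed.

Lemma det_frame (R : realType) : \det (\matrix_i frame R i) = 1.
Proof.
rewrite -[RHS](det1 R 4); congr (\det _); apply/matrixP => i j.
by rewrite !mxE eqxx eq_sym.
Qed.

Lemma det_metric_gt0 (R : realType) (l x : R) :
  0 < l -> 0 < x -> 0 < \det (metric l x).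
Proof.
move=> l0 x0; rewrite detZ det_diag mulr_gt0 ?exprn_gt0 //.
by apply: prodr_gt0 => j _; rewrite mxE; case: ifP; rewrite ?exprn_gt0.
Qed.

(** Left-invariant volume forms on K are invariant under the frame (K is
    unimodular: [v_i, v_m] has no v_m-component), so only the derivatives of
    the coefficients contribute. *)
Lemma div0E (R : realType) (l x : R) (a : section R) k :
  0 < l -> 0 < x ->
  div0 l x a k = \sum_i lder i (fun h => (a h).1 0 i) k.
Proof.
move=> l0 x0; have vol_n0 : Num.sqrt (\det (metric l x)) != 0.
  by rewrite gt_eqF // sqrtr_gt0 det_metric_gt0.
rewrite /div0 /volume det_frame mulr1.
apply: (mulIf vol_n0); rewrite divfK // /lie_volume /volume vder_cst sub0r.
rewrite -sumrN mulr_suml.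
apply: eq_bigr => i _.
(* M is the frame with its i-th row replaced by [X, v_i]. *)
set M := \matrix_j _.
have -> : \det M = lie_bracket (fun h => (a h).1) (fun=> frame R i) k 0 i.
  rewrite -det_replace_row; congr (\det _); apply/matrixP => r s; rewrite !mxE.
  by case: (r == i).
have := ev_lie_bracket_frame (frame R i) (fun h => (a h).1) i k.
rewrite /= coframe_bracket_diag sub0r.
rewrite /ev (bigD1 i) //= big1 ?addr0; last first.
  by move=> j ji; rewrite !mxE (negPf ji) mul0r.
rewrite mxE !eqxx mul1r => ->.
rewrite (bigD1 i) //= big1 ?addr0; last first.
  by move=> j ji; rewrite !mxE (negPf ji) mul0r.
by rewrite mxE !eqxx mul1r mulrN opprK mulrC.
Qed.

Lemma div_sswap (R : realType) (a : section R) k : T1_invariant a ->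
  \sum_i lder i (fun h => (sswap a h).1 0 i) k =
  \sum_i lder i (fun h => (a h).1 0 i) k.
Proof.
move=> aI; apply: eq_bigr => i _.
rewrite sswap_fst.
by case: eqVneq => [->|//]; rewrite !lder_i4 // => h s; rewrite aI.
Qed.

(** * The generalized metric and the complex structure under duality *)

Lemma flatE (R : realType) (l x : R) v j :
  flat l x v 0 j = l * (if j == i4 then x ^+ 2 else 1) * v 0 j.
Proof. by rewrite /flat -scalemxAr mxE mul_mx_diag !mxE mulrA mulrAC. Qed.

Lemma pairing_epsilon (R : realType) (x : R) a :
  pairing (epsilon x) a = - x * a.1 0 i4 / 2.
Proof.
rewrite /pairing /ev sum_I4 (eq_bigr (fun=> 0)) ?big1_eq => [|j _]; last first.
  by rewrite mxE mulr0.
by rewrite !mxE /= !mulr0 !mul0r !add0r addr0 mulr1.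
Qed.

Section DualRadii.
Variables (R : realType) (l x xhat : R).
Hypotheses (l0 : 0 < l) (x0 : 0 < x) (dual : xhat = 1 / (l * x)).

Lemma Vplus_fswap a : Vplus l x a -> Vplus l xhat (fswap a).
Proof.
rewrite /Vplus /= => aV; apply/rowP => j; rewrite flatE !mxE.
case: eqVneq => [->|ne]; rewrite aV flatE ?eqxx ?(negPf ne) // dual.
by field; rewrite !gt_eqF.
Qed.

Lemma divplus_sswap (a : section R) h k : red_sections (Vplus l x) a -> h.1 = k.1 ->
  divplus l xhat (sswap a) h = divplus l x a k.
Proof.
case=> aI _ _ aV hk; have xh0 : 0 < xhat by rewrite dual divr_gt0 ?mulr_gt0.
rewrite /divplus !div0E // div_sswap // !pairing_epsilon.
congr (_ - _).
  apply: eq_bigr => i _; apply: T1_invariant_fiber hk.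
  by apply: lder_T1_invariant => h' s; rewrite aI.
rewrite /sswap (T1_invariant_fiber aI hk) mxE eqxx (aV k) flatE eqxx dual.
by field; rewrite !gt_eqF.
Qed.

Lemma acsE (y : R) (v : 'rV[R]_4) :
  v *m acs y = \row_j (if j == i1 then y * v 0 i4 else if j == i2 then - v 0 i3
                       else if j == i3 then v 0 i2 else - y^-1 * v 0 i1).
Proof.
apply/rowP => j; rewrite !mxE sum_I4 !mxE /=.
by elim/I4_cases: j; rewrite /= ?mulr1n ?mulr0n; ring.
Qed.

Lemma Iplus_fswap a : Vplus l x a -> fswap (Iplus l x a) = Iplus l xhat (fswap a).
Proof.
have l_n0 : l != 0 by rewrite gt_eqF.
have x_n0 : x != 0 by rewrite gt_eqF.
rewrite /Vplus /= => aV.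
have a2 j : a.2 0 j = l * (if j == i4 then x ^+ 2 else 1) * a.1 0 j.
  by rewrite aV flatE.
rewrite /Iplus !acsE; congr pair; apply/rowP; elim/I4_cases;
by rewrite [LHS]mxE /= ?flatE ?[RHS]mxE /= !mxE /= ?a2 /= ?dual; field;
  rewrite ?l_n0 ?x_n0.
Qed.

End DualRadii.

(** * The four-dimensional Fock space *)

Section FockSpace.
Variable F : fieldType.

(** Two fermionic modes with annihilators n1, n2, creators c1, c2 and vacuum w. *)
Record fock_rep (kappa : F) (n1 n2 c1 c2 : 'M[F]_4) (w : 'cV[F]_4) : Prop := FockRep {
  fock_w : w != 0;
  fock_n1w : n1 *m w = 0;
  fock_n2w : n2 *m w = 0;
  fock_n1c1 : n1 *m c1 + c1 *m n1 = kappa%:M;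
  fock_n2c2 : n2 *m c2 + c2 *m n2 = kappa%:M;
  fock_n1c2 : n1 *m c2 + c2 *m n1 = 0;
  fock_n2c1 : n2 *m c1 + c1 *m n2 = 0;
  fock_c1c1 : c1 *m c1 = 0;
  fock_c2c2 : c2 *m c2 = 0;
  fock_c1c2 : c1 *m c2 + c2 *m c1 = 0
}.

Definition fock_vec (c1 c2 : 'M[F]_4) (w : 'cV[F]_4) (j : 'I_4) : 'cV[F]_4 :=
  nth 0 [:: w; c1 *m w; c2 *m w; c1 *m (c2 *m w)] j.

Definition fock_mx c1 c2 w : 'M[F]_4 := \matrix_(i, j) fock_vec c1 c2 w j i 0.

Lemma fock_mx_delta c1 c2 w j :
  fock_mx c1 c2 w *m delta_mx j 0 = fock_vec c1 c2 w j.
Proof. by rewrite -colE; apply/colP => i; rewrite !mxE. Qed.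

Lemma mx_eq_delta (A B : 'M[F]_4) :
  (forall j, A *m delta_mx j 0 = B *m delta_mx j 0 :> 'cV_4) -> A = B.
Proof.
by move=> AB; apply/matrixP => i j; have /colP/(_ i) := AB j; rewrite -!colE !mxE.
Qed.

(** The matrices of the four operators in the basis w, c1 w, c2 w, c1 c2 w. *)
Definition fock_n1 (kappa : F) : 'M[F]_4 :=
  kappa *: (delta_mx i1 i2 + delta_mx i3 i4).
Definition fock_n2 (kappa : F) : 'M[F]_4 :=
  kappa *: (delta_mx i1 i3 - delta_mx i2 i4).
Definition fock_c1 : 'M[F]_4 := delta_mx i2 i1 + delta_mx i4 i3.
Definition fock_c2 : 'M[F]_4 := delta_mx i3 i1 - delta_mx i4 i2.

Section Action.
Variables (kappa : F) (n1 n2 c1 c2 : 'M[F]_4) (w : 'cV[F]_4).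
Hypothesis rep : fock_rep kappa n1 n2 c1 c2 w.

Let swap_anti (A B : 'M[F]_4) (k : F) (v : 'cV[F]_4) :
  A *m B + B *m A = k%:M -> A *m (B *m v) = k *: v - B *m (A *m v).
Proof.
by move=> AB; rewrite !mulmxA -mul_scalar_mx -AB mulmxDl addrK.
Qed.

Let n1c1 := fun v => swap_anti v (fock_n1c1 rep).
Let n2c2 := fun v => swap_anti v (fock_n2c2 rep).
Let anti0 (A B : 'M[F]_4) (v : 'cV[F]_4) :
  A *m B + B *m A = 0 -> A *m (B *m v) = - (B *m (A *m v)).
Proof.
by move=> AB; apply/eqP; rewrite -addr_eq0 !mulmxA -mulmxDl AB mul0mx.
Qed.
Let n1c2 := fun v => anti0 v (fock_n1c2 rep).
Let n2c1 := fun v => anti0 v (fock_n2c1 rep).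
Let c2c1 (v : 'cV[F]_4) : c2 *m (c1 *m v) = - (c1 *m (c2 *m v)).
Proof. by rewrite (anti0 v (fock_c1c2 rep)) opprK. Qed.
Let c1c1 (v : 'cV[F]_4) : c1 *m (c1 *m v) = 0.
Proof. by rewrite mulmxA (fock_c1c1 rep) mul0mx. Qed.
Let c2c2 (v : 'cV[F]_4) : c2 *m (c2 *m v) = 0.
Proof. by rewrite mulmxA (fock_c2c2 rep) mul0mx. Qed.

Let fockE := (n1c1, n1c2, n2c1, n2c2, fock_n1w rep, fock_n2w rep).

Lemma fock_vec_n1 : [/\ n1 *m w = 0, n1 *m (c1 *m w) = kappa *: w,
   n1 *m (c2 *m w) = 0 & n1 *m (c1 *m (c2 *m w)) = kappa *: (c2 *m w)].
Proof. by split; rewrite !fockE ?mulmx0 ?subr0 ?oppr0 ?mulmx0 ?subr0. Qed.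

Lemma fock_vec_n2 : [/\ n2 *m w = 0, n2 *m (c1 *m w) = 0,
   n2 *m (c2 *m w) = kappa *: w
 & n2 *m (c1 *m (c2 *m w)) = - (kappa *: (c1 *m w))].
Proof.
by split; rewrite !fockE ?mulmx0 ?subr0 ?oppr0 // -scalemxAr.
Qed.

(** Moving annihilators to the right until they meet the vacuum expresses the
    action on the Fock basis by matrices in which only kappa occurs. *)
Lemma fock_mx_action :
  [/\ n1 *m fock_mx c1 c2 w = fock_mx c1 c2 w *m fock_n1 kappa,
      n2 *m fock_mx c1 c2 w = fock_mx c1 c2 w *m fock_n2 kappa,
      c1 *m fock_mx c1 c2 w = fock_mx c1 c2 w *m fock_c1
    & c2 *m fock_mx c1 c2 w = fock_mx c1 c2 w *m fock_c2].
Proof.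
have [n1_1 n1_2 n1_3 n1_4] := fock_vec_n1.
have [n2_1 n2_2 n2_3 n2_4] := fock_vec_n2.
split; apply: mx_eq_delta; elim/I4_cases;
  rewrite -!mulmxA fock_mx_delta /fock_n1 /fock_n2 /fock_c1 /fock_c2
    -?scalemxAl ?(mulmxDl, mulNmx) !mul_delta_mx_cond /= ?mulr1n ?mulr0n
    ?(subr0, addr0, add0r, sub0r, scaler0) ?(scalerN, mulmxN, mulmx0)
    -?scalemxAr ?fock_mx_delta /fock_vec /= ?c1c1 ?c2c1 ?c2c2 //.
by rewrite mulmx0 oppr0.
Qed.

(** Applying n1 n2 to a linear relation among the Fock vectors isolates the
    coefficient of c1 c2 w; then n1 and n2 isolate those of c1 w and c2 w. *)
Lemma fock_mx_unit : kappa != 0 -> fock_mx c1 c2 w \in unitmx.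
Proof.
move=> kappa0.
have [n1_1 n1_2 n1_3 n1_4] := fock_vec_n1.
have [n2_1 n2_2 n2_3 n2_4] := fock_vec_n2.
rewrite -unitmx_tr -row_free_unit; apply: inj_row_free => v.
move=> /(congr1 trmx); rewrite trmx_mul trmxK trmx0.
have -> : v^T = \sum_j v 0 j *: delta_mx j 0.
  by apply/colP => i; rewrite summxE (bigD1 i) //= big1 ?addr0 => [|j ji];
     rewrite !mxE ?eqxx ?mulr1 // eq_sym (negPf ji) mulr0.
rewrite mulmx_sumr sum_I4 -!scalemxAr !fock_mx_delta /fock_vec /= => rel.
have wI (s : F) : s *: w = 0 -> s = 0.
  by move=> /eqP; rewrite scaler_eq0 (negPf (fock_w rep)) orbF => /eqP.
(* v 0 ik is the coefficient of the k-th Fock vector in the relation. *)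
have v4 : v 0 i4 = 0.
  have := congr1 (mulmx n1) (congr1 (mulmx n2) rel).
  rewrite !mulmxDr -!scalemxAr n2_1 n2_2 n2_3 n2_4 !mulmx0 !scaler0 !add0r.
  rewrite mulmxN -!scalemxAr n1_1 n1_2 !scaler0 add0r.
  rewrite scalerN => /eqP; rewrite oppr_eq0 !scalerA => /eqP/wI/eqP.
  by rewrite !mulf_eq0 (negPf kappa0) !orbF => /eqP.
rewrite v4 scale0r addr0 in rel.
have v2 : v 0 i2 = 0.
  have := congr1 (mulmx n1) rel.
  rewrite !mulmxDr -!scalemxAr n1_1 n1_2 n1_3 mulmx0 !scaler0 add0r addr0.
  rewrite scalerA => /wI/eqP; by rewrite mulf_eq0 (negPf kappa0) orbF => /eqP.
have v3 : v 0 i3 = 0.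
  have := congr1 (mulmx n2) rel.
  rewrite !mulmxDr -!scalemxAr n2_1 n2_2 n2_3 mulmx0 !scaler0 !add0r.
  rewrite scalerA => /wI/eqP; by rewrite mulf_eq0 (negPf kappa0) orbF => /eqP.
rewrite v2 v3 !scale0r !addr0 in rel; have v1 := wI _ rel.
by apply/rowP; elim/I4_cases; rewrite ?v1 ?v2 ?v3 ?v4 mxE.
Qed.

End Action.

(** Both modules have the same matrices in their Fock bases, so the map that
    matches the bases intertwines the operators. *)
Lemma fock_intertwiner (kappa : F) n1 n2 c1 c2 w n1' n2' c1' c2' w' :
  kappa != 0 -> fock_rep kappa n1 n2 c1 c2 w -> fock_rep kappa n1' n2' c1' c2' w' ->
  exists2 P : 'M[F]_4, P \in unitmx &
    [/\ P *m n1 = n1' *m P, P *m n2 = n2' *m P, P *m c1 = c1' *m P,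
        P *m c2 = c2' *m P & P *m w = w'].
Proof.
move=> kappa0 rep rep'.
set f := fock_mx c1 c2 w; set f' := fock_mx c1' c2' w'.
have fU : f \in unitmx := fock_mx_unit rep kappa0.
have f'U : f' \in unitmx := fock_mx_unit rep' kappa0.
have [P PU PfE] : exists2 P, P \in unitmx & P *m f = f'.
  exists (f' *m invmx f); first by rewrite unitmx_mul f'U unitmx_inv.
  by rewrite -mulmxA mulVmx // mulmx1.
have intertwine (g g' N : 'M[F]_4) : g *m f = f *m N -> g' *m f' = f' *m N ->
    P *m g = g' *m P.
  move=> gf g'f'; apply: (can_inj (mulmxK fU)).
  by rewrite -!mulmxA gf PfE g'f' mulmxA PfE.
have [a1 a2 a3 a4] := fock_mx_action rep.
have [b1 b2 b3 b4] := fock_mx_action rep'.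
exists P => //.
split; [exact: intertwine a1 b1 | exact: intertwine a2 b2
  | exact: intertwine a3 b3 | exact: intertwine a4 b4 |].
have -> : w = f *m delta_mx i1 0 by rewrite fock_mx_delta.
by rewrite mulmxA PfE fock_mx_delta.
Qed.

End FockSpace.

(** * Pure spinors are Fock vacua *)

Section CliffordModules.
Variables (R : realType) (l x : R).
Hypotheses (l0 : 0 < l) (x0 : 0 < x).

Local Notation J v := (v *m acs x).
Local Notation g v w := (ev (flat l x v) w).
Local Notation graph v := (v, flat l x v).
Local Notation toC := (real_complex R).
Local Notation ii := (Complex (0 : R) 1).

Let x_n0 : x != 0. Proof. by rewrite gt_eqF. Qed.

Lemma metricE v w : g v w = l * (v 0 i1 * w 0 i1 + v 0 i2 * w 0 i2 + v 0 i3 * w 0 i3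
                          + x ^+ 2 * v 0 i4 * w 0 i4).
Proof. by rewrite /ev sum_I4 !flatE /=; ring. Qed.

Lemma metric_acs v w : g (J v) (J w) = g v w.
Proof. by rewrite !metricE !acsE !mxE /=; field. Qed.

Lemma metric_acsC v w : g (J v) w = - g v (J w).
Proof. by rewrite !metricE !acsE !mxE /=; field. Qed.

Lemma metricC v w : g v w = g w v. Proof. by rewrite !metricE; ring. Qed.

Lemma metricD u v w : g (u + v) w = g u w + g v w.
Proof. by rewrite !metricE !mxE; ring. Qed.

Lemma acsJ (v : 'rV[R]_4) : J (J v) = - v.
Proof. by apply/rowP; elim/I4_cases; rewrite !acsE !mxE /= //; field. Qed.

Lemma Vplus_graph v : Vplus l x (graph v). Proof. by []. Qed.

Lemma graph_linear c v w : graph (c *: v + w) = c *: graph v + graph w.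
Proof. by rewrite /flat mulmxDl -scalemxAl. Qed.

Lemma Vplus_graphE a : Vplus l x a -> a = graph a.1.
Proof. by case: a => v xi; rewrite /Vplus /= => ->. Qed.

Lemma pairing_graph v w : pairing (graph v) (graph w) = g v w.
Proof. by rewrite /pairing /= metricC; field. Qed.

Section Representation.
Variable rho : fiber R -> 'M[R[i]]_4.
Hypothesis hrho : clifford_action (Vplus l x) rho.
Local Notation r v := (rho (graph v)).

Lemma clifford_graph_linear c v w : r (c *: v + w) = toC c *: r v + r w.
Proof. by rewrite graph_linear hrho.1. Qed.

(** Polarization of the Clifford relation. *)
Lemma clifford_graph_anti v w : r v *m r w + r w *m r v = (toC (2 * g v w))%:M.
Proof.
have rr u : r u *m r u = (toC (g u u))%:M by rewrite hrho.2 // pairing_graph.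
have := rr (1 *: v + w).
rewrite clifford_graph_linear rmorph1 !scale1r mulmxDl !mulmxDr !rr.
have -> : g (v + w) (v + w) = g v v + (2 * g v w + g w w).
  by rewrite metricD ![g _ (v + w)]metricC !metricD (metricC w v); ring.
rewrite !rmorphD /= -!addrA => /addrI.
by rewrite !addrA => /addIr; rewrite addrC.
Qed.

(** Twice the Clifford action of the projection of v to the -s i-eigenspace of
    I_x, so s = -1 annihilates the pure spinor and s = 1 creates. *)
Definition ladder (s : R[i]) v := r v + (s * ii) *: r (J v).

(** I_x is an isometry, so the pairings of v, w and of I_x v, I_x w only differ
    by the sign of (i s) (i t).  For s = t = 1 or s = t = -1 everything cancels:
    the eigenspaces of I_x are isotropic. *)
Lemma ladder_anti s t v w :
  ladder s v *m ladder t w + ladder t w *m ladder s v =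
  (2 * (1 - s * t) * toC (g v w) + 2 * (t - s) * ii * toC (g v (J w)))%:M.
Proof.
have e1 := clifford_graph_anti v w; have e2 := clifford_graph_anti v (J w).
have e3 := clifford_graph_anti (J v) w; have e4 := clifford_graph_anti (J v) (J w).
rewrite metric_acs in e4; rewrite metric_acsC in e3.
rewrite /ladder !mulmxDl !mulmxDr -!scalemxAl -!scalemxAr.
have iiE : ii * ii = -1.
  apply/eqP; rewrite eq_complex /= !mulr0 !mul0r.
  by apply/andP; split; apply/eqP; ring.
move: e1 e2 e3 e4.
move: (r v) (r w) (r (J v)) (r (J w)) => A B C D.
move: (g v w) (g v (J w)) => a b.
move: (A *m B) (A *m D) (C *m B) (C *m D) (B *m A) (D *m A) (B *m C) (D *m C).
move=> AB AD CB CD BA DA BC DC e1 e2 e3 e4.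
(* Regroup into the four anticommutators before using their values. *)
rewrite -[LHS](_ : (AB + BA) + (t * ii) *: (AD + DA) + (s * ii) *: (CB + BC)
  + (s * t * (ii * ii)) *: (CD + DC) = _).
  rewrite e1 e2 e3 e4 iiE; apply/matrixP => i j; rewrite !mxE !rmorphM !rmorphN /=.
  by case: (i == j); rewrite ?mulr1n ?mulr0n ?rmorph_nat; ring.
by apply/matrixP => i j; rewrite !mxE; ring.
Qed.

Lemma pure_spinor_ladder eta v :
  pure_spinor (Vplus l x) (Iplus l x) rho eta -> ladder (-1) v *m eta = 0.
Proof.
case=> _ /(_ (graph v) (graph (- J v)) (Vplus_graph _) (Vplus_graph _)).
rewrite /Iplus /=.
have JN : J (- J v) = v by rewrite [LHS]mulNmx [v *m _ *m _](acsJ v) opprK.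
have graphN w : graph (- w) = - graph w.
  by rewrite /flat mulNmx.
rewrite JN graphN opprK => /(_ erefl erefl).
rewrite -graphN.
have -> : r (- J v) = - r (J v).
  have := clifford_graph_linear (-1) (J v) 0; rewrite !addr0 scaleN1r => ->.
  have -> : r 0 = 0.
    apply: (addrI (r 0)); have := clifford_graph_linear 1 0 0.
    by rewrite rmorph1 !scale1r !addr0.
  by rewrite addr0 rmorphN1 scaleN1r.
by rewrite /ladder mulN1r scaleNr scalerN.
Qed.

(** v_1 and v_2 span complementary complex lines: v_1, I v_1, v_2, I v_2 are
    orthogonal, of square norm l; hence kappa = 4 l. *)
Lemma ladder_fock eta : pure_spinor (Vplus l x) (Iplus l x) rho eta ->
  fock_rep (4 * toC l) (ladder (-1) (frame R i1)) (ladder (-1) (frame R i2))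
    (ladder 1 (frame R i1)) (ladder 1 (frame R i2)) eta.
Proof.
move=> pure.
have gs : [/\ g (frame R i1) (frame R i1) = l, g (frame R i2) (frame R i2) = l,
    g (frame R i1) (frame R i2) = 0, g (frame R i2) (frame R i1) = 0
  & forall i j, i \in [:: i1; i2] -> j \in [:: i1; i2] ->
    g (frame R i) (J (frame R j)) = 0].
  split; rewrite ?metricE ?mxE /=; try ring.
  by move=> i j; rewrite !inE => /orP[]/eqP-> /orP[]/eqP->;
     rewrite metricE acsE !mxE /=; ring.
case: gs => g11 g22 g12 g21 gJ0.
have sq0 v : ladder 1 v *m ladder 1 v = 0.
  have := ladder_anti 1 1 v v.
  rewrite mulr1 subrr !(mulr0, mul0r) addr0 raddf0 -mulr2n -scaler_nat => /eqP.
  by rewrite scaler_eq0 pnatr_eq0 => /eqP.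
split; rewrite ?pure_spinor_ladder ?ladder_anti ?gJ0 ?g11 ?g22 ?g12 ?g21 ?sq0 //.
- by case: pure => /eqP.
- by congr scalar_mx; rewrite rmorph0; ring.
- by congr scalar_mx; rewrite rmorph0; ring.
- by rewrite rmorph0 !mulr0 addr0 raddf0.
- by rewrite rmorph0 !mulr0 addr0 raddf0.
- by rewrite rmorph0 !mulr0 addr0 raddf0.
Qed.

Lemma ladder_frame m :
  r (frame R m) = 2^-1 *: (ladder 1 (frame R m) + ladder (-1) (frame R m)) /\
  r (J (frame R m)) =
    (2 * ii)^-1 *: (ladder 1 (frame R m) - ladder (-1) (frame R m)).
Proof.
have ii0 : ii != 0 by rewrite eq_complex /= oner_eq0 andbF.
split; apply/matrixP => i j; rewrite !mxE; field; rewrite ?ii0 //.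
Qed.

End Representation.

(** Nested in the form c *: u + w because Clifford actions are linear in that
    shape. *)
Lemma acs_frame_decomposition (v : 'rV[R]_4) :
  v = - x * v 0 i4 *: J (frame R i1) + (v 0 i3 *: J (frame R i2)
      + (v 0 i2 *: frame R i2 + (v 0 i1 *: frame R i1 + 0))).
Proof.
by apply/rowP; elim/I4_cases; rewrite !acsE !mxE /= ?mulr1n ?mulr0n; field.
Qed.

(** The complex Clifford module of a 4-dimensional space is unique, and so is
    the pure spinor line of a complex structure: both are read off from the
    Fock basis generated by the spinor. *)
Lemma pure_spinor_unique rho rho' eta eta' :
  clifford_action (Vplus l x) rho -> clifford_action (Vplus l x) rho' ->
  pure_spinor (Vplus l x) (Iplus l x) rho eta ->
  pure_spinor (Vplus l x) (Iplus l x) rho' eta' ->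
  exists2 P : 'M[R[i]]_4, P \in unitmx &
    (forall a, Vplus l x a -> P *m rho a = rho' a *m P) /\ P *m eta = eta'.
Proof.
move=> h h' p p'.
have k0 : 4 * toC l != 0 by rewrite mulf_neq0 ?pnatr_eq0 // fmorph_eq0 gt_eqF.
have [P PU [Pn1 Pn2 Pc1 Pc2 Pw]] :=
  fock_intertwiner k0 (ladder_fock h p) (ladder_fock h' p').
exists P => //; split=> // a /Vplus_graphE ->.
(* The vectors whose action P intertwines form a subspace. *)
pose S v := P *m rho (graph v) = rho' (graph v) *m P.
have S0 : S 0.
  have r0 f : clifford_action (Vplus l x) f -> f (graph 0) = 0.
    move=> hf; apply: (addrI (f (graph 0))).
    by have := clifford_graph_linear hf 1 0 0; rewrite rmorph1 !scale1r !addr0.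
  by rewrite /S (r0 _ h) (r0 _ h') mul0mx mulmx0.
have SP c v w : S v -> S w -> S (c *: v + w).
  move=> Sv Sw; rewrite /S (clifford_graph_linear h) (clifford_graph_linear h').
  by rewrite mulmxDr mulmxDl -scalemxAr -scalemxAl Sv Sw.
have Sf i : P *m ladder rho (-1) (frame R i) = ladder rho' (-1) (frame R i) *m P ->
    P *m ladder rho 1 (frame R i) = ladder rho' 1 (frame R i) *m P ->
    S (frame R i) /\ S (J (frame R i)).
  have PZD k (A A' B B' : 'M[R[i]]_4) : P *m A = A' *m P -> P *m B = B' *m P ->
      P *m (k *: (A + B)) = (k *: (A' + B')) *m P.
    by move=> PA PB; rewrite -scalemxAr -scalemxAl mulmxDr mulmxDl PA PB.
  move=> Pn Pc; have [e1 e2] := ladder_frame rho i.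
  have [e1' e2'] := ladder_frame rho' i.
  split; first by rewrite /S e1 e1'; apply: PZD.
  rewrite /S e2 e2'; apply: PZD; first exact: Pc.
  by rewrite mulmxN mulNmx; exact: congr1 Pn.
have [S1 SJ1] := Sf _ Pn1 Pc1; have [S2 SJ2] := Sf _ Pn2 Pc2.
rewrite -/(S _) (acs_frame_decomposition a.1).
exact: SP SJ1 (SP _ _ _ SJ2 (SP _ _ _ S2 (SP _ _ _ S1 S0))).
Qed.

End CliffordModules.

(** * The exchange of the triples *)

Lemma red_sections_sswap (R : realType) (V W : set (fiber R)) a :
  (forall f, V f -> W (fswap f)) -> red_sections V a -> red_sections W (sswap a).
Proof.
move=> VW [aI a1 a2 aV]; have [s1 s2] := sswap_components a1 a2.
split=> //; first exact: T1_invariant_sswap.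
by move=> k; apply: VW.
Qed.

(** Since the swap is an involution, surjectivity is the inclusion in the
    opposite direction. *)
Lemma image_psi_red_sections (R : realType) (V W : set (fiber R)) :
  (forall f, V f -> W (fswap f)) -> (forall f, W f -> V (fswap f)) ->
  (@psi R @` red_sections V = red_sections W)%classic.
Proof.
move=> VW WV; apply/seteqP; split=> [_ [a aV <-]|b bW].
  by rewrite psiE; [exact: red_sections_sswap aV | case: aV].
have bV := red_sections_sswap WV bW.
exists (sswap b) => //; rewrite psiE ?sswapK //; by case: bV.
Qed.

Lemma psi_courant_iso (R : realType) (l : R) : reduced_courant_iso l (@psi R).
Proof.
have GI a : red_sections [set: fiber R]%classic a -> T1_invariant a by case.
split.
  have im := @image_psi_red_sections R setT setT (fun _ _ => I) (fun _ _ => I).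
  split; [by move=> a aG; rewrite -im; exists a | | by rewrite /set_surj im].
  move=> a b /set_mem/GI aI /set_mem/GI bI; rewrite !psiE //.
  exact: (inv_inj (@sswapK R)).
move=> a b aG bG; have aI := GI _ aG; have bI := GI _ bG.
have az c : T1_invariant c -> forall z : Kbar R, c (qhat z) = c (q z).
  by move=> cI z; apply: T1_invariant_fiber => //; rewrite Kbar_fiber.
case: aG => _ a1 a2 _; case: bG => _ b1 b2 _.
have d f : (forall j, smooth (f j)) -> forall j : 'I_4, @fderivable R (f j).
  by move=> fs j; apply: smooth_fderivable.
have [da1 da2] := (d _ a1, d _ a2); have [db1 db2] := (d _ b1, d _ b2).
split.
- move=> u _; rewrite !psiE //; first by apply/funext => k; apply: fswap_linear.
  by move=> k s; rewrite T1_act_fst aI bI.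
- by move=> z; rewrite psiE // /sswap dproj_fswap az.
- by move=> z; rewrite !psiE // /sswap pairing_fswap !az.
- by rewrite !psiE ?dorfman_sswap //; apply: dorfman_T1_invariant.
Qed.

Theorem proposition4p14 (R : realType) (l x xhat : R)
    (rho rhohat : fiber R -> 'M[R[i]]_4) (eta etahat : 'cV[R[i]]_4)
    (hl : 0 < l) (hx : 0 < x) (hxhat : 0 < xhat)
    (hrho : clifford_action (Vplus l x) rho)
    (hrhohat : clifford_action (Vplus l xhat) rhohat)
    (heta : pure_spinor (Vplus l x) (Iplus l x) rho eta)
    (hetahat : pure_spinor (Vplus l xhat) (Iplus l xhat) rhohat etahat) :
  xhat = 1 / (l * x) ->
  exchanged_under_T_duality l (triple_at l x rho eta)
    (triple_at l xhat rhohat etahat).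
Proof.
move=> dual.
have lx0 : 0 < l * x by rewrite mulr_gt0.
have dual' : x = 1 / (l * xhat).
  by rewrite dual; field; rewrite !gt_eqF.
have VW := Vplus_fswap hl hx dual; have WV := Vplus_fswap hl hxhat dual'.
split.
- exact: psi_courant_iso.
- exact: image_psi_red_sections.
- move=> a aV z /=; rewrite psiE; last by case: aV.
  by apply: divplus_sswap => //; rewrite Kbar_fiber.
- move=> a aV; have [aI _ _ aV'] := aV; rewrite (psiE aI) psiE.
    by apply/funext => k; exact: Iplus_fswap hl hx dual _ (aV' k).
  by move=> k s; rewrite aI.
- (* Pull the dual Clifford module back along the swap, so that both modules
     are over the same V_+. *)
  have h' : clifford_action (Vplus l x) (rhohat \o @fswap R).
    split=> [c a b aV bV | a aV] /=.
      by rewrite fswap_linear hrhohat.1 //; apply: VW.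
    by rewrite hrhohat.2 ?pairing_fswap //; apply: VW.
  have p' : pure_spinor (Vplus l x) (Iplus l x) (rhohat \o @fswap R) etahat.
    case: hetahat => e0 ann; split=> // a b aV bV Ia Ib /=.
    by apply: ann; [exact: VW | exact: VW | |];
      rewrite -(Iplus_fswap hl hx dual) // ?Ia ?Ib ?fswapN.
  have [P PU [PI Pe]] := pure_spinor_unique hl hx hrho h' heta p'.
  exists P => //; split; last by exists 1; rewrite ?oner_neq0 // scale1r.
  by move=> a k aV; rewrite /= psiE // PI.
Qed.
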